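(* Each bi-liberalizable symmetric monoidal closed category (BiLSMCC) $\mathcal{C}$ gives a semantics of LLK$^-$ in $\sharp\mathcal{C}$, interpreting proofs of $A_1, \dots, A_m \vdash B_1, \dots, B_n$ as morphisms $A_1 \otimes \dots \otimes A_m \to B_1 ⅋ \dots ⅋ B_n$ in $\sharp\mathcal{C}$.
   Context: A new-Seely category (NSC) is a symmetric monoidal closed category $(\mathcal{C}, \otimes, \top, \multimap)$ with finite products $(1, \&)$ and a comonad $! = (!, \epsilon, \delta)$ such that the canonical adjunction between $\mathcal{C}$ and the co-Kleisli category $\mathcal{C}_!$ is monoidal, with natural isomorphisms $\top \cong !1$, $!A \otimes !B \cong !(A \& B)$; a backward-liberalizable (BwL) SMC is the same without $\multimap$. A forward-liberalizable (FwL) SMC $(\mathcal{C}, ⅋, \bot)$ has finite coproducts $(0,\oplus)$, a monad $? = (?, \eta, \mu)$ with monoidal canonical Kleisli adjunction, and natural isomorphisms $?0 \cong \bot$, $?(A \oplus B) \cong ?A ⅋ ?B$. A BiLSMCC is an NSC $\mathcal{C} = (\mathcal{C}, \otimes, \top, \multimap, !)$ with weak finite coproducts $(0, \oplus)$, equipped with: a lluf (same objects) sub-BwLSMC $\sharp\mathcal{C}$ and a triple $(⅋, \bot, ?)$ such that $\top$ is terminal and $\bot$ initial in $\sharp\mathcal{C}$, $\sharp\mathcal{C}(A, \bot) = \mathcal{C}(A, \bot)$, $\sharp\mathcal{C}(\top, B) = \mathcal{C}(\top, B)$, and $(\sharp \mathcal{C}, ⅋, \bot, ?)$ is FwL with finite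 coproducts $(0, \oplus)$; natural transformations in $\sharp\mathcal{C}$: $\Omega_{A,B,C} : A \otimes (B ⅋ C) \to (A \otimes B) ⅋ C$, $\Sigma_{A,B} : !(A ⅋ ?B) \to !A ⅋ ?B$, $\Pi_{A,B} : !A \otimes ?B \to ?(!A ⅋ B)$; natural isomorphisms in $\sharp\mathcal{C}$: $A ⅋ \top \cong \top$, $A \multimap B \cong \neg A ⅋ B$, $?(A \multimap B) \cong !A \multimap ?B$, $\neg A \oplus \neg B \cong \neg(A \& B)$ (with $\neg A = A \multimap \bot$); and a distributive law $\Upsilon : !? \Rightarrow ?!$ of $!$ over $?$. LLK$^-$ is the two-sided sequent calculus for propositional linear logic without linear negation ($\top$ unit of $\otimes$, $\bot$ unit of $⅋$, plus $1, 0, \&, \oplus, \multimap, !, ?$), obtained from the standard calculus LLK by restricting Cut to Cut$^-$ (from $\Delta \vdash B$, $\Delta', B \vdash \Gamma'$ infer $\Delta, \Delta' \vdash \Gamma'$), $\otimes$R to $\otimes$R$^-$ (from $\Delta_1 \vdash B_1$, $\Delta_2 \vdash B_2$ infer $\Delta_1, \Delta_2 \vdash B_1 \otimes B_2$), $⅋$L to $⅋$L$^-$ (from $A_1 \vdash \Gamma_1$, $A_2 \vdash \Gamma_2$ infer $A_1 ⅋ A_2 \vdash \Gamma_1, \Gamma_2$), $\&$R to $\&$R$^-$ (empty right context), $\oplus$L to $\oplus$L$^-$ (single formula on the left), $\multimap$R to $\multimap$R$^-$ (from $A \vdash B, \Gamma$ infer $\vdash A \multimap B, \Gamma$), and adding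 distribution rules: from $\Delta, ?!A \vdash \Gamma$ infer $\Delta, !?A \vdash \Gamma$; from $\Delta \vdash !?B, \Gamma$ infer $\Delta \vdash ?!B, \Gamma$; from $\Delta, (A \otimes B) ⅋ C \vdash \Gamma$ infer $\Delta, A, B ⅋ C \vdash \Gamma$; from $\Delta \vdash A \otimes (B ⅋ C), \Gamma$ infer $\Delta \vdash A \otimes B, C, \Gamma$. *)

(* Defs.v *)
From Stdlib Require Import List ProofIrrelevance.
Import ListNotations.

Set Implicit Arguments.
Unset Strict Implicit.
Unset Printing Implicit Defensive.

(** * Categories, functors, adjunctions *)

Record Category := {
  Ob :> Type;
  Hom : Ob -> Ob -> Type;
  idm : forall A, Hom A A;
  comp : forall A B C, Hom B C -> Hom A B -> Hom A C;
  comp_id_l : forall A B (f : Hom A B), comp (idm B) f = f;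
  comp_id_r : forall A B (f : Hom A B), comp f (idm A) = f;
  comp_assoc : forall A B C D (h : Hom C D) (g : Hom B C) (f : Hom A B),
    comp (comp h g) f = comp h (comp g f)
}.
Arguments Hom : clear implicits.
Arguments idm {c} A.
Arguments comp {c A B C} _ _.

Declare Scope cat_scope.
Open Scope cat_scope.
Notation "g ∘ f" := (comp g f) (at level 40, left associativity) : cat_scope.

Record Iso (C : Category) (A B : C) := {
  fwd : Hom C A B;
  bwd : Hom C B A;
  bwd_fwd : bwd ∘ fwd = idm A;
  fwd_bwd : fwd ∘ bwd = idm B
}.
Arguments Iso : clear implicits.

Definition op (C : Category) : Category.
Proof.
  refine {| Ob := Ob C;
            Hom := fun A B => Hom C B A;
            idm := fun A => @idm C A;
            comp := fun A B D g f => @comp C D B A f g |}.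
  - intros; apply comp_id_r.
  - intros; apply comp_id_l.
  - intros; symmetry; apply comp_assoc.
Defined.

Definition iso_op (C : Category) (A B : C) (i : Iso (op C) A B) : Iso C A B :=
  {| fwd := bwd i : Hom C A B;
     bwd := fwd i : Hom C B A;
     bwd_fwd := bwd_fwd i;
     fwd_bwd := fwd_bwd i |}.

Record Functor (C D : Category) := {
  fobj :> C -> D;
  fmap : forall A B, Hom C A B -> Hom D (fobj A) (fobj B);
  fmap_id : forall A, fmap (idm A) = idm (fobj A);
  fmap_comp : forall A B E (g : Hom C B E) (f : Hom C A B),
    fmap (g ∘ f) = fmap g ∘ fmap f
}.

(** [Adjunction F G] is [F ⊣ G]. *)
Record Adjunction (C D : Category) (F : Functor C D) (G : Functor D C) := {
  adj_unit : forall A : C, Hom C A (G (F A));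
  adj_counit : forall B : D, Hom D (F (G B)) B;
  unit_nat : forall (A A' : C) (f : Hom C A A'),
    adj_unit A' ∘ f = fmap G (fmap F f) ∘ adj_unit A;
  counit_nat : forall (B B' : D) (g : Hom D B B'),
    adj_counit B' ∘ fmap F (fmap G g) = g ∘ adj_counit B;
  triangle_l : forall A : C, adj_counit (F A) ∘ fmap F (adj_unit A) = idm (F A);
  triangle_r : forall B : D, fmap G (adj_counit B) ∘ adj_unit (G B) = idm (G B)
}.

Record Terminal (C : Category) (t : C) := {
  bang_to : forall A : C, Hom C A t;
  bang_to_uniq : forall (A : C) (f : Hom C A t), f = bang_to A
}.

Definition Initial (C : Category) (z : C) := @Terminal (op C) z.

Definition from_initial (C : Category) (z : C) (i : Initial z) (A : C) :
  Hom C z A := @bang_to (op C) z i A.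

Record FinProducts (C : Category) (P : C -> C -> C) (one : C) := {
  one_terminal : Terminal one;
  fst_ : forall A B, Hom C (P A B) A;
  snd_ : forall A B, Hom C (P A B) B;
  pair_ : forall X A B, Hom C X A -> Hom C X B -> Hom C X (P A B);
  pair_fst : forall X A B (f : Hom C X A) (g : Hom C X B),
    fst_ A B ∘ pair_ f g = f;
  pair_snd : forall X A B (f : Hom C X A) (g : Hom C X B),
    snd_ A B ∘ pair_ f g = g;
  pair_uniq : forall X A B (h : Hom C X (P A B)),
    h = pair_ (fst_ A B ∘ h) (snd_ A B ∘ h)
}.
Arguments fst_ {C P one} _ A B.
Arguments snd_ {C P one} _ A B.

Record WeakFinCoproducts (C : Category) (S : C -> C -> C) (zero : C) := {
  weak_initial : forall A : C, exists f : Hom C zero A, True;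
  winl : forall A B, Hom C A (S A B);
  winr : forall A B, Hom C B (S A B);
  weak_copair : forall A B X (f : Hom C A X) (g : Hom C B X),
    exists h : Hom C (S A B) X, h ∘ winl A B = f /\ h ∘ winr A B = g
}.
Arguments winl {C S zero} _ A B.
Arguments winr {C S zero} _ A B.

(** * Symmetric monoidal categories *)

Record SymMonoidal (C : Category) (T : C -> C -> C) (I : C) := {
  tensm : forall A A' B B', Hom C A A' -> Hom C B B' -> Hom C (T A B) (T A' B');
  assoc : forall A B D, Iso C (T (T A B) D) (T A (T B D));
  lunit : forall A, Iso C (T I A) A;
  runit : forall A, Iso C (T A I) A;
  swap : forall A B, Hom C (T A B) (T B A);
  tensm_id : forall A B, tensm (idm A) (idm B) = idm (T A B);
  tensm_comp : forall A A' A'' B B' B''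
      (f' : Hom C A' A'') (f : Hom C A A') (g' : Hom C B' B'') (g : Hom C B B'),
    tensm (f' ∘ f) (g' ∘ g) = tensm f' g' ∘ tensm f g;
  assoc_nat : forall A A' B B' D D'
      (f : Hom C A A') (g : Hom C B B') (h : Hom C D D'),
    fwd (assoc A' B' D') ∘ tensm (tensm f g) h
    = tensm f (tensm g h) ∘ fwd (assoc A B D);
  lunit_nat : forall A A' (f : Hom C A A'),
    fwd (lunit A') ∘ tensm (idm I) f = f ∘ fwd (lunit A);
  runit_nat : forall A A' (f : Hom C A A'),
    fwd (runit A') ∘ tensm f (idm I) = f ∘ fwd (runit A);
  swap_nat : forall A A' B B' (f : Hom C A A') (g : Hom C B B'),
    swap A' B' ∘ tensm f g = tensm g f ∘ swap A B;
  swap_swap : forall A B, swap B A ∘ swap A B = idm (T A B);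
  triangle : forall A B,
    tensm (idm A) (fwd (lunit B)) ∘ fwd (assoc A I B)
    = tensm (fwd (runit A)) (idm B);
  pentagon : forall A B D E,
    fwd (assoc A B (T D E)) ∘ fwd (assoc (T A B) D E)
    = tensm (idm A) (fwd (assoc B D E)) ∘ fwd (assoc A (T B D) E)
      ∘ tensm (fwd (assoc A B D)) (idm E);
  hexagon : forall A B D,
    fwd (assoc B D A) ∘ swap A (T B D) ∘ fwd (assoc A B D)
    = tensm (idm B) (swap A D) ∘ fwd (assoc B A D) ∘ tensm (swap A B) (idm D)
}.
Arguments assoc {C T I} _ A B D.
Arguments lunit {C T I} _ A.
Arguments runit {C T I} _ A.
Arguments swap {C T I} _ A B.

Record Closed (C : Category) (T : C -> C -> C) (I : C) (M : SymMonoidal T I)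
    (L : C -> C -> C) := {
  eval : forall A B, Hom C (T (L A B) A) B;
  curry : forall X A B, Hom C (T X A) B -> Hom C X (L A B);
  curry_eval : forall X A B (f : Hom C (T X A) B),
    eval A B ∘ tensm M (curry f) (idm A) = f;
  curry_uniq : forall X A B (h : Hom C X (L A B)),
    h = curry (eval A B ∘ tensm M h (idm A))
}.
Arguments eval {C T I M L} _ A B.

Definition lolm (C : Category) (T : C -> C -> C) (I : C) (M : SymMonoidal T I)
    (L : C -> C -> C) (cl : Closed M L) (A A' B B' : C)
    (f : Hom C A' A) (g : Hom C B B') : Hom C (L A B) (L A' B') :=
  curry cl (g ∘ eval cl A B ∘ tensm M (idm (L A B)) f).

Record IsLaxSymMonoidal (C D : Category)
    (T : C -> C -> C) (I : C) (M : SymMonoidal T I)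
    (T' : D -> D -> D) (I' : D) (N : SymMonoidal T' I')
    (F : Functor C D)
    (m : forall A B : C, Hom D (T' (F A) (F B)) (F (T A B)))
    (m0 : Hom D I' (F I)) : Prop := {
  lax_nat : forall (A A' B B' : C) (f : Hom C A A') (g : Hom C B B'),
    m A' B' ∘ tensm N (fmap F f) (fmap F g) = fmap F (tensm M f g) ∘ m A B;
  lax_assoc : forall A B E : C,
    fmap F (fwd (assoc M A B E)) ∘ m (T A B) E ∘ tensm N (m A B) (idm (F E))
    = m A (T B E) ∘ tensm N (idm (F A)) (m B E)
      ∘ fwd (assoc N (F A) (F B) (F E));
  lax_lunit : forall A : C,
    fmap F (fwd (lunit M A)) ∘ m I A ∘ tensm N m0 (idm (F A))
    = fwd (lunit N (F A));
  lax_runit : forall A : C,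
    fmap F (fwd (runit M A)) ∘ m A I ∘ tensm N (idm (F A)) m0
    = fwd (runit N (F A));
  lax_swap : forall A B : C,
    fmap F (swap M A B) ∘ m A B = m B A ∘ swap N (F A) (F B)
}.

(** Both adjoints are lax symmetric monoidal, and the unit and the counit are
    monoidal natural transformations. *)
Record IsMonoidalAdjunction (C D : Category)
    (T : C -> C -> C) (I : C) (M : SymMonoidal T I)
    (T' : D -> D -> D) (I' : D) (N : SymMonoidal T' I')
    (F : Functor C D) (G : Functor D C) (adj : Adjunction F G)
    (m : forall A B : C, Hom D (T' (F A) (F B)) (F (T A B)))
    (m0 : Hom D I' (F I))
    (n : forall A B : D, Hom C (T (G A) (G B)) (G (T' A B)))
    (n0 : Hom C I (G I')) : Prop := {
  left_monoidal : IsLaxSymMonoidal M N m m0;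
  right_monoidal : IsLaxSymMonoidal N M n n0;
  unit_monoidal : forall A B : C,
    adj_unit adj (T A B)
    = fmap G (m A B) ∘ n (F A) (F B) ∘ tensm M (adj_unit adj A) (adj_unit adj B);
  unit_monoidal0 : adj_unit adj I = fmap G m0 ∘ n0;
  counit_monoidal : forall A B : D,
    adj_counit adj (T' A B) ∘ fmap F (n A B) ∘ m (G A) (G B)
    = tensm N (adj_counit adj A) (adj_counit adj B);
  counit_monoidal0 : adj_counit adj I' ∘ fmap F n0 ∘ m0 = idm I'
}.

Section Cartesian.
Context (C : Category) (P : C -> C -> C) (one : C) (fp : FinProducts P one).

Lemma pair_ext X A B (h k : Hom C X (P A B)) :
  fst_ fp A B ∘ h = fst_ fp A B ∘ k -> snd_ fp A B ∘ h = snd_ fp A B ∘ k ->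
  h = k.
Proof.
  intros e1 e2; rewrite (pair_uniq fp h), (pair_uniq fp k), e1, e2; reflexivity.
Qed.

Lemma one_ext X (h k : Hom C X one) : h = k.
Proof.
  rewrite (bang_to_uniq (one_terminal fp) h), (bang_to_uniq (one_terminal fp) k).
  reflexivity.
Qed.

Lemma fst_pair' X Y A B (f : Hom C X A) (g : Hom C X B) (h : Hom C Y X) :
  fst_ fp A B ∘ (pair_ fp f g ∘ h) = f ∘ h.
Proof. rewrite <- comp_assoc, pair_fst; reflexivity. Qed.

Lemma snd_pair' X Y A B (f : Hom C X A) (g : Hom C X B) (h : Hom C Y X) :
  snd_ fp A B ∘ (pair_ fp f g ∘ h) = g ∘ h.
Proof. rewrite <- comp_assoc, pair_snd; reflexivity. Qed.

Ltac cart :=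
  intros;
  repeat rewrite ?comp_assoc, ?fst_pair', ?snd_pair', ?pair_fst, ?pair_snd,
    ?comp_id_l, ?comp_id_r;
  first [ reflexivity
        | solve [apply one_ext]
        | (apply pair_ext; cart) ].

Definition cartesian : SymMonoidal P one.
Proof.
  unshelve refine {|
    tensm := fun A A' B B' f g =>
      pair_ fp (f ∘ fst_ fp A B) (g ∘ snd_ fp A B);
    assoc := fun A B D => {|
      fwd := pair_ fp (fst_ fp A B ∘ fst_ fp (P A B) D)
               (pair_ fp (snd_ fp A B ∘ fst_ fp (P A B) D) (snd_ fp (P A B) D));
      bwd := pair_ fp (pair_ fp (fst_ fp A (P B D))
                         (fst_ fp B D ∘ snd_ fp A (P B D)))
               (snd_ fp B D ∘ snd_ fp A (P B D)) |};
    lunit := fun A => {|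
      fwd := snd_ fp one A;
      bwd := pair_ fp (bang_to (one_terminal fp) A) (idm A) |};
    runit := fun A => {|
      fwd := fst_ fp A one;
      bwd := pair_ fp (idm A) (bang_to (one_terminal fp) A) |};
    swap := fun A B => pair_ fp (snd_ fp A B) (fst_ fp A B) |};
  simpl; cart.
Defined.

End Cartesian.

(** * Comonads and co-Kleisli categories *)

Record Comonad (C : Category) (W : C -> C) := {
  wmap : forall A B, Hom C A B -> Hom C (W A) (W B);
  eps : forall A, Hom C (W A) A;
  delta : forall A, Hom C (W A) (W (W A));
  wmap_id : forall A, wmap (idm A) = idm (W A);
  wmap_comp : forall A B D (g : Hom C B D) (f : Hom C A B),
    wmap (g ∘ f) = wmap g ∘ wmap f;
  eps_nat : forall A B (f : Hom C A B), eps B ∘ wmap f = f ∘ eps A;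
  delta_nat : forall A B (f : Hom C A B),
    delta B ∘ wmap f = wmap (wmap f) ∘ delta A;
  eps_delta : forall A, eps (W A) ∘ delta A = idm (W A);
  wmap_eps_delta : forall A, wmap (eps A) ∘ delta A = idm (W A);
  delta_delta : forall A, delta (W A) ∘ delta A = wmap (delta A) ∘ delta A
}.
Arguments eps {C W} _ A.
Arguments delta {C W} _ A.

Section CoKleisli.
Context (C : Category) (W : C -> C) (cm : Comonad W).

Definition coKleisli : Category.
Proof.
  refine {| Ob := Ob C;
            Hom := fun A B => Hom C (W A) B;
            idm := fun A => eps cm A;
            comp := fun A B D (g : Hom C (W B) D) (f : Hom C (W A) B) =>
              g ∘ wmap cm f ∘ delta cm A |}.
  - intros A B f; rewrite (eps_nat cm), comp_assoc, eps_delta.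
    apply comp_id_r.
  - intros A B f; rewrite comp_assoc, wmap_eps_delta; apply comp_id_r.
  - intros A B D E h g f.
    rewrite !(wmap_comp cm), !comp_assoc, <- (delta_delta cm A).
    rewrite <- (comp_assoc (wmap cm (wmap cm f))), <- (delta_nat cm f).
    rewrite !comp_assoc; reflexivity.
Defined.

Lemma coKleisli_linear (A B D : C) (k : Hom C B D) (f : Hom C (W A) B) :
  k ∘ eps cm B ∘ wmap cm f ∘ delta cm A = k ∘ f.
Proof.
  rewrite (comp_assoc k), (eps_nat cm), !comp_assoc, eps_delta, comp_id_r.
  reflexivity.
Qed.

Definition coKleisli_products (P : C -> C -> C) (one : C)
    (fp : FinProducts P one) : @FinProducts coKleisli P one.
Proof.
  unshelve refine (@Build_FinProducts coKleisli P one _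
    (fun A B => fst_ fp A B ∘ eps cm (P A B))
    (fun A B => snd_ fp A B ∘ eps cm (P A B))
    (fun X A B f g => @pair_ C P one fp (W X) A B f g) _ _ _).
  - exact (@Build_Terminal coKleisli one
      (fun A => bang_to (one_terminal fp) (W A))
      (fun A f => bang_to_uniq (one_terminal fp) f)).
  - intros X A B f g; simpl in *; rewrite coKleisli_linear; apply pair_fst.
  - intros X A B f g; simpl in *; rewrite coKleisli_linear; apply pair_snd.
  - intros X A B h; simpl in *; rewrite !coKleisli_linear; apply pair_uniq.
Defined.

Definition coKleisli_left : Functor coKleisli C.
Proof.
  unshelve refine (@Build_Functor coKleisli C W
    (fun A B (f : Hom C (W A) B) => wmap cm f ∘ delta cm A) _ _).
  - intros A; apply wmap_eps_delta.
  - intros A B E g f; simpl in *.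
    rewrite !(wmap_comp cm), !comp_assoc, <- (delta_delta cm A).
    rewrite <- (comp_assoc (wmap cm (wmap cm f))), <- (delta_nat cm f).
    rewrite !comp_assoc; reflexivity.
Defined.

Definition coKleisli_right : Functor C coKleisli.
Proof.
  unshelve refine (@Build_Functor C coKleisli (fun A => A)
    (fun A B f => f ∘ eps cm A) _ _).
  - intros A; exact (comp_id_l (eps cm A)).
  - intros A B E g f; simpl in *.
    rewrite coKleisli_linear; apply comp_assoc.
Defined.

Definition coKleisli_adj : Adjunction coKleisli_left coKleisli_right.
Proof.
  unshelve refine (@Build_Adjunction coKleisli C coKleisli_left coKleisli_right
    (fun A => @idm C (W A)) (fun B => eps cm B) _ _ _ _).
  - intros A A' f; simpl in *.
    rewrite comp_id_l, !comp_assoc, wmap_id, comp_id_l, eps_delta, comp_id_r.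
    reflexivity.
  - intros B B' g; simpl in *.
    rewrite <- comp_assoc, (eps_nat cm), !comp_assoc, eps_delta, comp_id_r.
    reflexivity.
  - intros A; simpl in *.
    rewrite wmap_id, comp_id_l; apply eps_delta.
  - intros B; simpl in *.
    rewrite wmap_id, comp_id_r, comp_assoc, eps_delta, comp_id_r; reflexivity.
Defined.

End CoKleisli.

(** * Liberalizable symmetric monoidal categories *)

(** The object part of the structure is kept as a parameter so that two
    categories on the same objects can share it on the nose. *)
Record LinOps (X : Type) := {
  tens_o : X -> X -> X;
  tunit_o : X;
  prod_o : X -> X -> X;
  punit_o : X;
  excl_o : X -> X
}.

Record BwLSMC (C : Category) (O : LinOps C) := {
  bw_sm : @SymMonoidal C (tens_o O) (tunit_o O);
  bw_prod : @FinProducts C (prod_o O) (punit_o O);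
  bw_excl : @Comonad C (excl_o O);
  seely2 : forall A B : C,
    Iso C (tens_o O (excl_o O A) (excl_o O B)) (excl_o O (prod_o O A B));
  seely0 : Iso C (tunit_o O) (excl_o O (punit_o O));
  bw_monoidal :
    exists n n0,
      @IsMonoidalAdjunction (coKleisli bw_excl) C
        (prod_o O) (punit_o O) (cartesian (coKleisli_products bw_excl bw_prod))
        (tens_o O) (tunit_o O) bw_sm
        (coKleisli_left bw_excl) (coKleisli_right bw_excl)
        (coKleisli_adj bw_excl)
        (fun A B => fwd (seely2 A B)) (fwd seely0) n n0
}.

(** Forward liberalizability is the dual notion: coproducts, the monad [?] and
    its Kleisli adjunction are those of [C] seen in the opposite category. *)
Definition FwLSMC (C : Category) (par : C -> C -> C) (bot : C)
    (plus : C -> C -> C) (zero : C) (whynot : C -> C) :=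
  @BwLSMC (op C) (@Build_LinOps (op C) par bot plus zero whynot).

Record NSC (C : Category) (O : LinOps C) (L : C -> C -> C) := {
  nsc_bwl :> BwLSMC O;
  nsc_closed : Closed (bw_sm nsc_bwl) L
}.

Definition discard (C : Category) (O : LinOps C) (B : BwLSMC O) (A : C) :
    Hom C (excl_o O A) (tunit_o O) :=
  bwd (seely0 B) ∘ wmap (bw_excl B) (bang_to (one_terminal (bw_prod B)) A).
Definition duplicate (C : Category) (O : LinOps C) (B : BwLSMC O) (A : C) :
    Hom C (excl_o O A) (tens_o O (excl_o O A) (excl_o O A)) :=
  bwd (seely2 B A A)
  ∘ wmap (bw_excl B) (pair_ (bw_prod B) (idm A) (idm A)).

Record Lluf (C : Category) := {
  lluf_in : forall A B, Hom C A B -> Prop;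
  lluf_id : forall A, lluf_in (idm A);
  lluf_comp : forall A B D (g : Hom C B D) (f : Hom C A B),
    lluf_in g -> lluf_in f -> lluf_in (g ∘ f)
}.

Definition subcat (C : Category) (S : Lluf C) : Category.
Proof.
  refine {| Ob := Ob C;
            Hom := fun A B => {f : Hom C A B | lluf_in S f};
            idm := fun A => exist _ (idm A) (lluf_id S A);
            comp := fun A B D g f =>
              exist _ (proj1_sig g ∘ proj1_sig f)
                (lluf_comp (proj2_sig g) (proj2_sig f)) |}.
  - intros A B f; apply eq_sig_hprop; [intros; apply proof_irrelevance|].
    apply comp_id_l.
  - intros A B f; apply eq_sig_hprop; [intros; apply proof_irrelevance|].
    apply comp_id_r.
  - intros A B D E h g f; apply eq_sig_hprop; [intros; apply proof_irrelevance|].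
    apply comp_assoc.
Defined.

Definition sub_incl (C : Category) (S : Lluf C) (A B : C)
  (f : Hom (subcat S) A B) : Hom C A B := proj1_sig f.

(** The structure of the subcategory is the restriction of the ambient one.
    Inverses, pairings and maps to [1] are then preserved as well, being unique. *)
Record IsSubBwLSMC (C : Category) (O : LinOps C) (B : BwLSMC O)
    (S : Lluf C) (B' : @BwLSMC (subcat S) O) : Prop := {
  sub_tensm : forall (A A' D D' : C)
      (f : Hom (subcat S) A A') (g : Hom (subcat S) D D'),
    sub_incl (tensm (bw_sm B') f g) = tensm (bw_sm B) (sub_incl f) (sub_incl g);
  sub_assoc : forall A D E : C,
    sub_incl (fwd (assoc (bw_sm B') A D E)) = fwd (assoc (bw_sm B) A D E);
  sub_lunit : forall A : C,
    sub_incl (fwd (lunit (bw_sm B') A)) = fwd (lunit (bw_sm B) A);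
  sub_runit : forall A : C,
    sub_incl (fwd (runit (bw_sm B') A)) = fwd (runit (bw_sm B) A);
  sub_swap : forall A D : C,
    sub_incl (swap (bw_sm B') A D) = swap (bw_sm B) A D;
  sub_fst : forall A D : C,
    sub_incl (fst_ (bw_prod B') A D) = fst_ (bw_prod B) A D;
  sub_snd : forall A D : C,
    sub_incl (snd_ (bw_prod B') A D) = snd_ (bw_prod B) A D;
  sub_wmap : forall (A A' : C) (f : Hom (subcat S) A A'),
    sub_incl (wmap (bw_excl B') f) = wmap (bw_excl B) (sub_incl f);
  sub_eps : forall A : C, sub_incl (eps (bw_excl B') A) = eps (bw_excl B) A;
  sub_delta : forall A : C, sub_incl (delta (bw_excl B') A) = delta (bw_excl B) A;
  sub_seely2 : forall A D : C, sub_incl (fwd (seely2 B' A D)) = fwd (seely2 B A D);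
  sub_seely0 : sub_incl (fwd (seely0 B')) = fwd (seely0 B)
}.

(** * Bi-liberalizable symmetric monoidal closed categories *)

Record BiLData := {
  bcat :> Category;
  bops : LinOps bcat;
  lolli : bcat -> bcat -> bcat;
  bnsc : NSC bops lolli;
  par : bcat -> bcat -> bcat;
  bot : bcat;
  plus : bcat -> bcat -> bcat;
  zero : bcat;
  whynot : bcat -> bcat;
  bweak : WeakFinCoproducts plus zero;
  blluf : Lluf bcat;
  sbwl : @BwLSMC (subcat blluf) bops;
  sbwl_sub : IsSubBwLSMC bnsc sbwl;
  sfwl : @FwLSMC (subcat blluf) par bot plus zero whynot;
  (* [A -> A ⊕ B] in the subcategory is a first projection of its opposite. *)
  sinl_weak : forall A B : bcat,
    sub_incl (S := blluf) (fst_ (bw_prod sfwl) A B) = winl bweak A B;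
  sinr_weak : forall A B : bcat,
    sub_incl (S := blluf) (snd_ (bw_prod sfwl) A B) = winr bweak A B;
  top_terminal : @Terminal (subcat blluf) (tunit_o bops);
  bot_initial : @Initial (subcat blluf) bot;
  lluf_to_bot : forall (A : bcat) (f : Hom bcat A bot), lluf_in blluf f;
  lluf_from_top : forall (B : bcat) (f : Hom bcat (tunit_o bops) B),
    lluf_in blluf f;
  (* [⊸] is a functor on the subcategory: presupposed by the natural
     isomorphisms in it that involve [⊸] and [¬]. *)
  lluf_lolm : forall (A A' B B' : bcat) (f : Hom bcat A' A) (g : Hom bcat B B'),
    lluf_in blluf f -> lluf_in blluf g ->
    lluf_in blluf (lolm (nsc_closed bnsc) f g)
}.

Section BiLOps.
Context (C : BiLData).

Definition sharp : Category := subcat (blluf C).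

Definition tens : C -> C -> C := tens_o (bops C).
Definition top : C := tunit_o (bops C).
Definition with_ : C -> C -> C := prod_o (bops C).
Definition one : C := punit_o (bops C).
Definition excl : C -> C := excl_o (bops C).
Definition neg (A : C) : C := lolli A (bot C).

Definition tens_sm : @SymMonoidal sharp tens top := bw_sm (sbwl C).
Definition with_fp : @FinProducts sharp with_ one := bw_prod (sbwl C).
Definition excl_cm : @Comonad sharp excl := bw_excl (sbwl C).
Definition par_sm : @SymMonoidal (op sharp) (@par C) (bot C) := bw_sm (sfwl C).
Definition plus_fp : @FinProducts (op sharp) (@plus C) (zero C) :=
  bw_prod (sfwl C).
Definition whynot_cm : @Comonad (op sharp) (@whynot C) := bw_excl (sfwl C).

Definition stens (A A' B B' : C) (f : Hom sharp A A') (g : Hom sharp B B') :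
  Hom sharp (tens A B) (tens A' B') := tensm tens_sm f g.
Definition swith (A A' B B' : C) (f : Hom sharp A A') (g : Hom sharp B B') :
  Hom sharp (with_ A B) (with_ A' B') := tensm (cartesian with_fp) f g.
Definition sexcl (A B : C) (f : Hom sharp A B) :
  Hom sharp (excl A) (excl B) := wmap excl_cm f.
Definition slol (A A' B B' : C) (f : Hom sharp A' A) (g : Hom sharp B B') :
  Hom sharp (lolli A B) (lolli A' B') :=
  exist _ (lolm (nsc_closed (bnsc C)) (sub_incl f) (sub_incl g))
    (lluf_lolm (proj2_sig f) (proj2_sig g)).
Definition sneg (A A' : C) (f : Hom sharp A' A) :
  Hom sharp (neg A) (neg A') := slol f (@idm sharp (bot C)).

Definition spar (A A' B B' : C) (f : Hom sharp A A') (g : Hom sharp B B') :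
  Hom sharp (par A B) (par A' B') := @tensm _ _ _ par_sm A' A B' B f g.
Definition splus (A A' B B' : C) (f : Hom sharp A A') (g : Hom sharp B B') :
  Hom sharp (plus A B) (plus A' B') :=
  @tensm _ _ _ (cartesian plus_fp) A' A B' B f g.
Definition swhynot (A B : C) (f : Hom sharp A B) :
  Hom sharp (whynot A) (whynot B) := @wmap _ _ whynot_cm B A f.

Definition par_assoc (A B D : C) :
  Iso sharp (par (par A B) D) (par A (par B D)) := iso_op (assoc par_sm A B D).
Definition par_lunit (A : C) : Iso sharp (par (bot C) A) A :=
  iso_op (lunit par_sm A).
Definition par_runit (A : C) : Iso sharp (par A (bot C)) A :=
  iso_op (runit par_sm A).
Definition par_swap (A B : C) : Hom sharp (par A B) (par B A) :=
  swap par_sm B A.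

Definition counit_excl (A : C) : Hom sharp (excl A) A := eps excl_cm A.
Definition comult_excl (A : C) : Hom sharp (excl A) (excl (excl A)) :=
  delta excl_cm A.
Definition unit_whynot (A : C) : Hom sharp A (whynot A) := eps whynot_cm A.
Definition mult_whynot (A : C) : Hom sharp (whynot (whynot A)) (whynot A) :=
  delta whynot_cm A.

End BiLOps.

Arguments tens {C} _ _.
Arguments top {C}.
Arguments with_ {C} _ _.
Arguments one {C}.
Arguments excl {C} _.
Arguments neg {C} _.

Record BiLSMCC := {
  bdata :> BiLData;

  Omega : forall A B D : bdata,
    Hom (sharp bdata) (tens A (par B D)) (par (tens A B) D);
  Omega_nat : forall (A A' B B' D D' : bdata)
      (f : Hom (sharp bdata) A A') (g : Hom (sharp bdata) B B')
      (h : Hom (sharp bdata) D D'),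
    Omega A' B' D' ∘ stens f (spar g h) = spar (stens f g) h ∘ Omega A B D;

  Sigma : forall A B : bdata,
    Hom (sharp bdata) (excl (par A (whynot B))) (par (excl A) (whynot B));
  Sigma_nat : forall (A A' B B' : bdata)
      (f : Hom (sharp bdata) A A') (g : Hom (sharp bdata) B B'),
    Sigma A' B' ∘ sexcl (spar f (swhynot g))
    = spar (sexcl f) (swhynot g) ∘ Sigma A B;

  Pi : forall A B : bdata,
    Hom (sharp bdata) (tens (excl A) (whynot B)) (whynot (par (excl A) B));
  Pi_nat : forall (A A' B B' : bdata)
      (f : Hom (sharp bdata) A A') (g : Hom (sharp bdata) B B'),
    Pi A' B' ∘ stens (sexcl f) (swhynot g)
    = swhynot (spar (sexcl f) g) ∘ Pi A B;

  par_top : forall A : bdata, Iso (sharp bdata) (par A top) top;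
  par_top_nat : forall (A A' : bdata) (f : Hom (sharp bdata) A A'),
    fwd (par_top A') ∘ spar f (idm (c := sharp bdata) top)
    = fwd (par_top A);

  lol_par : forall A B : bdata, Iso (sharp bdata) (lolli A B) (par (neg A) B);
  lol_par_nat : forall (A A' B B' : bdata)
      (f : Hom (sharp bdata) A' A) (g : Hom (sharp bdata) B B'),
    fwd (lol_par A' B') ∘ slol f g = spar (sneg f) g ∘ fwd (lol_par A B);

  whynot_lol : forall A B : bdata,
    Iso (sharp bdata) (whynot (lolli A B)) (lolli (excl A) (whynot B));
  whynot_lol_nat : forall (A A' B B' : bdata)
      (f : Hom (sharp bdata) A' A) (g : Hom (sharp bdata) B B'),
    fwd (whynot_lol A' B') ∘ swhynot (slol f g)
    = slol (sexcl f) (swhynot g) ∘ fwd (whynot_lol A B);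

  plus_neg : forall A B : bdata,
    Iso (sharp bdata) (plus (neg A) (neg B)) (neg (with_ A B));
  plus_neg_nat : forall (A A' B B' : bdata)
      (f : Hom (sharp bdata) A' A) (g : Hom (sharp bdata) B' B),
    fwd (plus_neg A' B') ∘ splus (sneg f) (sneg g)
    = sneg (swith f g) ∘ fwd (plus_neg A B);

  Upsilon : forall A : bdata,
    Hom (sharp bdata) (excl (whynot A)) (whynot (excl A));
  Upsilon_nat : forall (A B : bdata) (f : Hom (sharp bdata) A B),
    Upsilon B ∘ sexcl (swhynot f) = swhynot (sexcl f) ∘ Upsilon A;
  Upsilon_counit : forall A : bdata,
    swhynot (counit_excl A) ∘ Upsilon A = counit_excl (whynot A);
  Upsilon_comult : forall A : bdata,
    swhynot (comult_excl A) ∘ Upsilon A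
    = Upsilon (excl A) ∘ sexcl (Upsilon A) ∘ comult_excl (whynot A);
  Upsilon_unit : forall A : bdata,
    Upsilon A ∘ sexcl (unit_whynot A) = unit_whynot (excl A);
  Upsilon_mult : forall A : bdata,
    Upsilon A ∘ sexcl (mult_whynot A)
    = mult_whynot (excl A) ∘ swhynot (Upsilon A) ∘ Upsilon (whynot A)
}.

Arguments Omega : clear implicits.
Arguments Sigma : clear implicits.
Arguments lol_par : clear implicits.
Arguments Upsilon : clear implicits.

(** * The calculus *)

Inductive form (Atom : Type) : Type :=
| FVar (X : Atom)
| FTop | FBot | FOne | FZero
| FTens (A B : form Atom)
| FPar (A B : form Atom)
| FWith (A B : form Atom)
| FPlus (A B : form Atom)
| FLol (A B : form Atom)
| FExcl (A : form Atom)
| FWhynot (A : form Atom).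
Arguments FTop {Atom}.
Arguments FBot {Atom}.
Arguments FOne {Atom}.
Arguments FZero {Atom}.

Declare Scope form_scope.
Delimit Scope form_scope with form.
Bind Scope form_scope with form.
Notation "A ⊗ B" := (FTens A B) (at level 41, right associativity) : form_scope.
Notation "A ⅋ B" := (FPar A B) (at level 43, right associativity) : form_scope.
Notation "A & B" := (FWith A B) (at level 42, right associativity) : form_scope.
Notation "A ⊕ B" := (FPlus A B) (at level 44, right associativity) : form_scope.
Notation "A ⊸ B" := (FLol A B) (at level 45, right associativity) : form_scope.
Notation "! A" := (FExcl A) (at level 9, right associativity) : form_scope.
Notation "? A" := (FWhynot A) (at level 9, right associativity) : form_scope.

Section Calculus.
Context (Atom : Type).
Local Notation form := (form Atom).
Local Open Scope form_scope.

Reserved Notation "Δ ⊢ Γ" (at level 70, no associativity).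

Inductive LLKm : list form -> list form -> Type :=
| r_id (A : form) : [A] ⊢ [A]
| r_cut (Δ Δ' Γ' : list form) (B : form) :
    Δ ⊢ [B] -> Δ' ++ [B] ⊢ Γ' -> Δ ++ Δ' ⊢ Γ'
| r_exL (Δ Δ' Γ : list form) (A B : form) :
    Δ ++ A :: B :: Δ' ⊢ Γ -> Δ ++ B :: A :: Δ' ⊢ Γ
| r_exR (Δ Γ Γ' : list form) (A B : form) :
    Δ ⊢ Γ ++ A :: B :: Γ' -> Δ ⊢ Γ ++ B :: A :: Γ'
| r_topL (Δ Γ : list form) : Δ ⊢ Γ -> Δ ++ [FTop] ⊢ Γ
| r_topR : [] ⊢ [FTop]
| r_botL : [FBot] ⊢ []
| r_botR (Δ Γ : list form) : Δ ⊢ Γ -> Δ ⊢ FBot :: Γ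
| r_oneR (Δ Γ : list form) : Δ ⊢ FOne :: Γ
| r_zeroL (Δ Γ : list form) : Δ ++ [FZero] ⊢ Γ
| r_tensL (Δ Γ : list form) (A B : form) :
    Δ ++ [A; B] ⊢ Γ -> Δ ++ [A ⊗ B] ⊢ Γ
| r_tensR (Δ1 Δ2 : list form) (A B : form) :
    Δ1 ⊢ [A] -> Δ2 ⊢ [B] -> Δ1 ++ Δ2 ⊢ [A ⊗ B]
| r_parL (Γ1 Γ2 : list form) (A B : form) :
    [A] ⊢ Γ1 -> [B] ⊢ Γ2 -> [A ⅋ B] ⊢ Γ1 ++ Γ2
| r_parR (Δ Γ : list form) (A B : form) :
    Δ ⊢ A :: B :: Γ -> Δ ⊢ (A ⅋ B) :: Γ
| r_withL1 (Δ Γ : list form) (A B : form) :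
    Δ ++ [A] ⊢ Γ -> Δ ++ [A & B] ⊢ Γ
| r_withL2 (Δ Γ : list form) (A B : form) :
    Δ ++ [B] ⊢ Γ -> Δ ++ [A & B] ⊢ Γ
| r_withR (Δ : list form) (A B : form) :
    Δ ⊢ [A] -> Δ ⊢ [B] -> Δ ⊢ [A & B]
| r_plusL (Γ : list form) (A B : form) :
    [A] ⊢ Γ -> [B] ⊢ Γ -> [A ⊕ B] ⊢ Γ
| r_plusR1 (Δ Γ : list form) (A B : form) :
    Δ ⊢ A :: Γ -> Δ ⊢ (A ⊕ B) :: Γ
| r_plusR2 (Δ Γ : list form) (A B : form) :
    Δ ⊢ B :: Γ -> Δ ⊢ (A ⊕ B) :: Γ
| r_lolL (Δ1 Δ2 Γ1 Γ2 : list form) (A B : form) :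
    Δ1 ⊢ A :: Γ1 -> Δ2 ++ [B] ⊢ Γ2 ->
    Δ1 ++ Δ2 ++ [A ⊸ B] ⊢ Γ1 ++ Γ2
| r_lolR (Γ : list form) (A B : form) :
    [A] ⊢ B :: Γ -> [] ⊢ (A ⊸ B) :: Γ
| r_exclW (Δ Γ : list form) (A : form) : Δ ⊢ Γ -> Δ ++ [! A] ⊢ Γ
| r_exclC (Δ Γ : list form) (A : form) :
    Δ ++ [! A; ! A] ⊢ Γ -> Δ ++ [! A] ⊢ Γ
| r_exclD (Δ Γ : list form) (A : form) : Δ ++ [A] ⊢ Γ -> Δ ++ [! A] ⊢ Γ
| r_exclR (Δ Γ : list form) (B : form) :
    map (@FExcl Atom) Δ ⊢ B :: map (@FWhynot Atom) Γ ->
    map (@FExcl Atom) Δ ⊢ ! B :: map (@FWhynot Atom) Γ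
| r_whynotW (Δ Γ : list form) (B : form) : Δ ⊢ Γ -> Δ ⊢ ? B :: Γ
| r_whynotC (Δ Γ : list form) (B : form) :
    Δ ⊢ ? B :: ? B :: Γ -> Δ ⊢ ? B :: Γ
| r_whynotD (Δ Γ : list form) (B : form) : Δ ⊢ B :: Γ -> Δ ⊢ ? B :: Γ
| r_whynotL (Δ Γ : list form) (A : form) :
    map (@FExcl Atom) Δ ++ [A] ⊢ map (@FWhynot Atom) Γ ->
    map (@FExcl Atom) Δ ++ [? A] ⊢ map (@FWhynot Atom) Γ
| r_distL (Δ Γ : list form) (A : form) :
    Δ ++ [? ! A] ⊢ Γ -> Δ ++ [! ? A] ⊢ Γ
| r_distR (Δ Γ : list form) (B : form) :
    Δ ⊢ ! ? B :: Γ -> Δ ⊢ ? ! B :: Γ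
| r_tpL (Δ Γ : list form) (A B D : form) :
    Δ ++ [(A ⊗ B) ⅋ D] ⊢ Γ -> Δ ++ [A; B ⅋ D] ⊢ Γ
| r_tpR (Δ Γ : list form) (A B D : form) :
    Δ ⊢ (A ⊗ (B ⅋ D)) :: Γ -> Δ ⊢ (A ⊗ B) :: D :: Γ
where "Δ ⊢ Γ" := (LLKm Δ Γ).

End Calculus.

Arguments r_id {Atom} A.
Arguments r_topR {Atom}.
Arguments r_botL {Atom}.
Arguments r_oneR {Atom} Δ Γ.
Arguments r_zeroL {Atom} Δ Γ.
Arguments r_exR {Atom Δ} Γ Γ' A B _.
Arguments r_exL {Atom} Δ Δ' {Γ} A B _.
Arguments r_parL {Atom Γ1 Γ2 A B} _ _.
Arguments r_tensR {Atom Δ1 Δ2 A B} _ _.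
Arguments r_cut {Atom Δ Δ' Γ' B} _ _.
Arguments r_lolL {Atom Δ1 Δ2 Γ1 Γ2 A B} _ _.
Arguments r_exclR {Atom Δ Γ B} _.
Arguments r_whynotL {Atom Δ Γ A} _.

(** * Iterated tensor products and their coherence isomorphisms *)

Section Iso.
Context (C : Category).

Definition iso_id (A : C) : Iso C A A :=
  {| fwd := idm A; bwd := idm A;
     bwd_fwd := comp_id_l (idm A); fwd_bwd := comp_id_l (idm A) |}.

Definition iso_sym (A B : C) (i : Iso C A B) : Iso C B A :=
  {| fwd := bwd i; bwd := fwd i; bwd_fwd := fwd_bwd i; fwd_bwd := bwd_fwd i |}.

Definition iso_comp (A B D : C) (j : Iso C B D) (i : Iso C A B) : Iso C A D.
Proof.
  refine {| fwd := fwd j ∘ fwd i; bwd := bwd i ∘ bwd j |}.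
  - rewrite comp_assoc, <- (comp_assoc (bwd j)), bwd_fwd, comp_id_l.
    apply bwd_fwd.
  - rewrite comp_assoc, <- (comp_assoc (fwd i)), fwd_bwd, comp_id_l.
    apply fwd_bwd.
Defined.

Context (T : C -> C -> C) (I : C) (M : SymMonoidal T I).

Definition iso_tens (A A' B B' : C) (i : Iso C A A') (j : Iso C B B') :
  Iso C (T A B) (T A' B').
Proof.
  refine {| fwd := tensm M (fwd i) (fwd j); bwd := tensm M (bwd i) (bwd j) |}.
  - rewrite <- tensm_comp, !bwd_fwd; apply tensm_id.
  - rewrite <- tensm_comp, !fwd_bwd; apply tensm_id.
Defined.

Context (X : Type) (f : X -> C).

(** [A1 ⊗ (A2 ⊗ ... ⊗ An)]: the unit for [n = 0], just [A1] for [n = 1]. *)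
Fixpoint big (l : list X) : C :=
  match l with
  | [] => I
  | x :: l' => match l' with [] => f x | _ :: _ => T (f x) (big l') end
  end.

Definition big_cons (x : X) (l : list X) :
    Iso C (big (x :: l)) (T (f x) (big l)) :=
  match l return Iso C (big (x :: l)) (T (f x) (big l)) with
  | [] => iso_sym (runit M (f x))
  | y :: l' => iso_id (T (f x) (big (y :: l')))
  end.

Fixpoint big_app (l1 l2 : list X) :
    Iso C (big (l1 ++ l2)) (T (big l1) (big l2)) :=
  match l1 return Iso C (big (l1 ++ l2)) (T (big l1) (big l2)) with
  | [] => iso_sym (lunit M (big l2))
  | x :: l1' =>
      iso_comp (iso_tens (iso_sym (big_cons x l1')) (iso_id (big l2)))
        (iso_comp (iso_sym (assoc M (f x) (big l1') (big l2)))
          (iso_comp (iso_tens (iso_id (f x)) (big_app l1' l2))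
            (big_cons x (l1' ++ l2))))
  end.

Definition big_exch (l l' : list X) (x y : X) :
    Hom C (big (l ++ y :: x :: l')) (big (l ++ x :: y :: l')) :=
  bwd (big_app l (x :: y :: l'))
  ∘ tensm M (idm (big l))
      (bwd (big_app [x; y] l')
       ∘ tensm M (swap M (f y) (f x)) (idm (big l'))
       ∘ fwd (big_app [y; x] l'))
  ∘ fwd (big_app l (y :: x :: l')).

End Iso.

(** [!A1 ⊗ ... ⊗ !An ≅ !(A1 & ... & An)], where [h] is [!] on the names [X] of
    the objects. *)
Fixpoint big_seely (C : Category) (O : LinOps C) (B : BwLSMC O) (X : Type)
    (f : X -> C) (h : X -> X)
    (hf : forall x, Iso C (f (h x)) (excl_o O (f x))) (l : list X) :
    Iso C (big (tens_o O) (tunit_o O) f (map h l))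
      (excl_o O (big (prod_o O) (punit_o O) f l)) :=
  match l with
  | [] => seely0 B
  | x :: l' =>
      match l' return
        Iso C (big (tens_o O) (tunit_o O) f (map h l'))
          (excl_o O (big (prod_o O) (punit_o O) f l')) ->
        Iso C (big (tens_o O) (tunit_o O) f (map h (x :: l')))
          (excl_o O (big (prod_o O) (punit_o O) f (x :: l')))
      with
      | [] => fun _ => hf x
      | y :: l'' => fun i =>
          iso_comp (seely2 B (f x) (big (prod_o O) (punit_o O) f (y :: l'')))
            (iso_tens (bw_sm B) (hf x) i)
      end (big_seely B hf l')
  end.

(** * Interpretations *)

Section Interpretation.
Context (Atom : Type) (C : BiLSMCC) (v : Atom -> bdata C).
Local Notation form := (form Atom).
Local Notation D := (sharp (bdata C)).
Local Notation "1_ A" := (@idm D A) (at level 9).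

Fixpoint interp (A : form) : bdata C :=
  match A with
  | FVar X => v X
  | FTop => top
  | FBot => bot (bdata C)
  | FOne => one
  | FZero => zero (bdata C)
  | FTens A B => tens (interp A) (interp B)
  | FPar A B => par (interp A) (interp B)
  | FWith A B => with_ (interp A) (interp B)
  | FPlus A B => plus (interp A) (interp B)
  | FLol A B => lolli (interp A) (interp B)
  | FExcl A => excl (interp A)
  | FWhynot A => whynot (interp A)
  end.
Local Notation "⟦ A ⟧" := (interp A) (at level 0, A at level 99).

Definition lctx (Δ : list form) : D := @big D tens top form interp Δ.
Definition rctx (Γ : list form) : D :=
  @big (op D) (@par (bdata C)) (bot (bdata C)) form interp Γ.

Definition lapp (Δ Δ' : list form) :
    Iso D (lctx (Δ ++ Δ')) (tens (lctx Δ) (lctx Δ')) :=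
  big_app (tens_sm (bdata C)) interp Δ Δ'.
Definition rapp (Γ Γ' : list form) :
    Iso D (rctx (Γ ++ Γ')) (par (rctx Γ) (rctx Γ')) :=
  iso_op (big_app (par_sm (bdata C)) interp Γ Γ').
Definition lexch (Δ Δ' : list form) (A B : form) :
    Hom D (lctx (Δ ++ B :: A :: Δ')) (lctx (Δ ++ A :: B :: Δ')) :=
  big_exch (tens_sm (bdata C)) interp Δ Δ' A B.
Definition rexch (Γ Γ' : list form) (A B : form) :
    Hom D (rctx (Γ ++ A :: B :: Γ')) (rctx (Γ ++ B :: A :: Γ')) :=
  big_exch (par_sm (bdata C)) interp Γ Γ' A B.

(** [f] on the last factors of a left context, on the first ones of a right
    context. *)
Definition onL (Δ Φ Ψ : list form) (f : Hom D (lctx Φ) (lctx Ψ)) :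
    Hom D (lctx (Δ ++ Φ)) (lctx (Δ ++ Ψ)) :=
  bwd (lapp Δ Ψ) ∘ stens (1_ (lctx Δ)) f ∘ fwd (lapp Δ Φ).
Definition onR (Φ Ψ Γ : list form) (f : Hom D (rctx Φ) (rctx Ψ)) :
    Hom D (rctx (Φ ++ Γ)) (rctx (Ψ ++ Γ)) :=
  bwd (rapp Ψ Γ) ∘ spar f (1_ (rctx Γ)) ∘ fwd (rapp Φ Γ).

Arguments onL : clear implicits.
Arguments onR : clear implicits.

Definition lexcl (Δ : list form) :
    Iso D (lctx (map (@FExcl Atom) Δ))
      (excl (@big D with_ one form interp Δ)) :=
  big_seely (sbwl (bdata C)) (h := @FExcl Atom)
    (fun A => @iso_id D (excl ⟦A⟧)) Δ.
Definition rwhynot (Γ : list form) :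
    Iso D (rctx (map (@FWhynot Atom) Γ))
      (whynot (@big (op D) (@plus (bdata C)) (zero (bdata C)) form interp Γ)) :=
  iso_op (big_seely (sfwl (bdata C)) (h := @FWhynot Atom)
    (fun A => @iso_id (op D) (whynot ⟦A⟧)) Γ).

(** A compositional interpretation of proofs in [♯C]. The rules [1R] and
    [0L] have no premise: the codomain of [1R] is terminal, and [0L] factors
    through [0]. The other rules are interpreted by the structure of [♯C],
    except that the left rule for [?] with a nonempty left context is only
    required to be interpreted as a function of its premise: the codomain
    [?(!A ⅋ B)] of [Pi] does not match its premise [!A ⊗ B -> ?E]. *)
Record Semantics := {
  den : forall (Δ Γ : list form), LLKm Δ Γ -> Hom D (lctx Δ) (rctx Γ);

  den_id : forall A, den (r_id A) = 1_ ⟦A⟧;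
  den_cut : forall Δ Δ' Γ' B (p : LLKm Δ [B]) (q : LLKm (Δ' ++ [B]) Γ'),
    den (r_cut p q)
    = den q ∘ bwd (lapp Δ' [B]) ∘ swap (tens_sm (bdata C)) ⟦B⟧ (lctx Δ')
      ∘ stens (den p) (1_ (lctx Δ')) ∘ fwd (lapp Δ Δ');
  den_exL : forall Δ Δ' Γ A B (p : LLKm (Δ ++ A :: B :: Δ') Γ),
    den (r_exL Δ Δ' A B p) = den p ∘ lexch Δ Δ' A B;
  den_exR : forall Δ Γ Γ' A B (p : LLKm Δ (Γ ++ A :: B :: Γ')),
    den (r_exR Γ Γ' A B p) = rexch Γ Γ' A B ∘ den p;

  den_topL : forall Δ Γ (p : LLKm Δ Γ),
    den (r_topL p)
    = den p ∘ fwd (runit (tens_sm (bdata C)) (lctx Δ)) ∘ fwd (lapp Δ [FTop]);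
  den_topR : den r_topR = 1_ top;
  den_botL : den r_botL = 1_ (bot (bdata C));
  den_botR : forall Δ Γ (p : LLKm Δ Γ),
    den (r_botR p)
    = bwd (rapp [FBot] Γ) ∘ bwd (par_lunit (rctx Γ)) ∘ den p;

  annihilate : forall A : bdata C,
    Hom D (tens A (zero (bdata C))) (zero (bdata C));
  den_zeroL : forall Δ Γ,
    den (r_zeroL Δ Γ)
    = from_initial (one_terminal (plus_fp (bdata C))) (rctx Γ)
      ∘ annihilate (lctx Δ) ∘ fwd (lapp Δ [FZero]);

  den_tensL : forall Δ Γ A B (p : LLKm (Δ ++ [A; B]) Γ),
    den (r_tensL p)
    = den p ∘ onL Δ [FTens A B] [A; B] (1_ (tens ⟦A⟧ ⟦B⟧));
  den_tensR : forall Δ1 Δ2 A B (p : LLKm Δ1 [A]) (q : LLKm Δ2 [B]),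
    den (r_tensR p q) = stens (den p) (den q) ∘ fwd (lapp Δ1 Δ2);
  den_parL : forall Γ1 Γ2 A B (p : LLKm [A] Γ1) (q : LLKm [B] Γ2),
    den (r_parL p q) = bwd (rapp Γ1 Γ2) ∘ spar (den p) (den q);
  den_parR : forall Δ Γ A B (p : LLKm Δ (A :: B :: Γ)),
    den (r_parR p)
    = onR [A; B] [FPar A B] Γ (1_ (par ⟦A⟧ ⟦B⟧)) ∘ den p;

  den_withL1 : forall Δ Γ A B (p : LLKm (Δ ++ [A]) Γ),
    den (r_withL1 B p)
    = den p ∘ onL Δ [FWith A B] [A] (fst_ (with_fp (bdata C)) ⟦A⟧ ⟦B⟧);
  den_withL2 : forall Δ Γ A B (p : LLKm (Δ ++ [B]) Γ),
    den (r_withL2 A p)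
    = den p ∘ onL Δ [FWith A B] [B] (snd_ (with_fp (bdata C)) ⟦A⟧ ⟦B⟧);
  den_withR : forall Δ A B (p : LLKm Δ [A]) (q : LLKm Δ [B]),
    den (r_withR p q)
    = @pair_ D _ _ (with_fp (bdata C)) (lctx Δ) ⟦A⟧ ⟦B⟧ (den p) (den q);
  den_plusL : forall Γ A B (p : LLKm [A] Γ) (q : LLKm [B] Γ),
    den (r_plusL p q)
    = @pair_ (op D) _ _ (plus_fp (bdata C)) (rctx Γ) ⟦A⟧ ⟦B⟧ (den p) (den q);
  den_plusR1 : forall Δ Γ A B (p : LLKm Δ (A :: Γ)),
    den (r_plusR1 B p)
    = onR [A] [FPlus A B] Γ (fst_ (plus_fp (bdata C)) ⟦A⟧ ⟦B⟧) ∘ den p;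
  den_plusR2 : forall Δ Γ A B (p : LLKm Δ (B :: Γ)),
    den (r_plusR2 A p)
    = onR [B] [FPlus A B] Γ (snd_ (plus_fp (bdata C)) ⟦A⟧ ⟦B⟧) ∘ den p;

  (* application in [♯C], via [A ⊸ B ≅ ¬A ⅋ B] and [A ⊗ ¬A -> ⊥] *)
  apply : forall A B : bdata C, Hom D (tens (lolli A B) A) B;
  apply_spec : forall (A B : bdata C)
      (e : Hom D (tens A (neg A)) (bot (bdata C))),
    sub_incl e = eval (nsc_closed (bnsc (bdata C))) A (bot (bdata C))
             ∘ swap (bw_sm (bnsc (bdata C))) A (neg A) ->
    apply A B
    = fwd (par_lunit B) ∘ spar e (1_ B) ∘ Omega C A (neg A) B
      ∘ stens (1_ A) (fwd (lol_par C A B))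
      ∘ swap (tens_sm (bdata C)) (lolli A B) A;
  den_lolL : forall Δ1 Δ2 Γ1 Γ2 A B
      (p : LLKm Δ1 (A :: Γ1)) (q : LLKm (Δ2 ++ [B]) Γ2),
    den (r_lolL p q)
    = bwd (rapp Γ1 Γ2) ∘ par_swap (rctx Γ2) (rctx Γ1)
      ∘ spar (den q ∘ bwd (lapp Δ2 [B])
              ∘ stens (1_ (lctx Δ2)) (apply ⟦A⟧ ⟦B⟧)
              ∘ fwd (assoc (tens_sm (bdata C))
                       (lctx Δ2) (lolli ⟦A⟧ ⟦B⟧) ⟦A⟧))
          (1_ (rctx Γ1))
      ∘ Omega C (tens (lctx Δ2) (lolli ⟦A⟧ ⟦B⟧)) ⟦A⟧ (rctx Γ1)
      ∘ swap (tens_sm (bdata C)) (par ⟦A⟧ (rctx Γ1))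
          (tens (lctx Δ2) (lolli ⟦A⟧ ⟦B⟧))
      ∘ stens (fwd (rapp [A] Γ1) ∘ den p) (fwd (lapp Δ2 [FLol A B]))
      ∘ fwd (lapp Δ1 (Δ2 ++ [FLol A B]));
  (* the name [⊤ -> A ⊸ (B, Γ)] of the premise, taken in [C] *)
  den_lolR : forall Γ A B (p : LLKm [A] (B :: Γ)),
    sub_incl (den (r_lolR p))
    = sub_incl (bwd (rapp [FLol A B] Γ)
            ∘ spar (bwd (lol_par C ⟦A⟧ ⟦B⟧)) (1_ (rctx Γ))
            ∘ bwd (par_assoc (neg ⟦A⟧) ⟦B⟧ (rctx Γ))
            ∘ spar (1_ (neg ⟦A⟧)) (fwd (rapp [B] Γ))
            ∘ fwd (lol_par C ⟦A⟧ (rctx (B :: Γ))))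
      ∘ curry (nsc_closed (bnsc (bdata C)))
          (sub_incl (den p) ∘ fwd (lunit (bw_sm (bnsc (bdata C))) ⟦A⟧));

  den_exclW : forall Δ Γ A (p : LLKm Δ Γ),
    den (r_exclW A p)
    = den p ∘ fwd (runit (tens_sm (bdata C)) (lctx Δ))
      ∘ stens (1_ (lctx Δ)) (discard (sbwl (bdata C)) ⟦A⟧)
      ∘ fwd (lapp Δ [FExcl A]);
  den_exclC : forall Δ Γ A (p : LLKm (Δ ++ [FExcl A; FExcl A]) Γ),
    den (r_exclC p)
    = den p ∘ onL Δ [FExcl A] [FExcl A; FExcl A]
                (duplicate (sbwl (bdata C)) ⟦A⟧);
  den_exclD : forall Δ Γ A (p : LLKm (Δ ++ [A]) Γ),
    den (r_exclD p) = den p ∘ onL Δ [FExcl A] [A] (counit_excl ⟦A⟧);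
  den_exclR : forall Δ Γ B
      (p : LLKm (map (@FExcl Atom) Δ) (B :: map (@FWhynot Atom) Γ)),
    den (r_exclR p)
    = bwd (rapp [FExcl B] (map (@FWhynot Atom) Γ))
      ∘ spar (1_ (excl ⟦B⟧)) (bwd (rwhynot Γ))
      ∘ Sigma C ⟦B⟧ _
      ∘ sexcl (spar (1_ ⟦B⟧) (fwd (rwhynot Γ))
               ∘ fwd (rapp [B] (map (@FWhynot Atom) Γ))
               ∘ den p ∘ bwd (lexcl Δ))
      ∘ comult_excl _ ∘ fwd (lexcl Δ);
  den_whynotW : forall Δ Γ B (p : LLKm Δ Γ),
    den (r_whynotW B p)
    = bwd (rapp [FWhynot B] Γ)
      ∘ spar (discard (sfwl (bdata C)) ⟦B⟧ : Hom D (bot (bdata C)) _)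
          (1_ (rctx Γ))
      ∘ bwd (par_lunit (rctx Γ)) ∘ den p;
  den_whynotC : forall Δ Γ B (p : LLKm Δ (FWhynot B :: FWhynot B :: Γ)),
    den (r_whynotC p)
    = onR [FWhynot B; FWhynot B] [FWhynot B] Γ
        (duplicate (sfwl (bdata C)) ⟦B⟧) ∘ den p;
  den_whynotD : forall Δ Γ B (p : LLKm Δ (B :: Γ)),
    den (r_whynotD p) = onR [B] [FWhynot B] Γ (unit_whynot ⟦B⟧) ∘ den p;
  den_whynotL : forall Δ Γ A
      (p p' : LLKm (map (@FExcl Atom) Δ ++ [A]) (map (@FWhynot Atom) Γ)),
    den p = den p' -> den (r_whynotL p) = den (r_whynotL p');
  den_whynotL_nil : forall Γ A (p : LLKm [A] (map (@FWhynot Atom) Γ)),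
    den (r_whynotL (Δ := []) p)
    = bwd (rwhynot Γ) ∘ mult_whynot _ ∘ swhynot (fwd (rwhynot Γ) ∘ den p);

  den_distL : forall Δ Γ A (p : LLKm (Δ ++ [FWhynot (FExcl A)]) Γ),
    den (r_distL p)
    = den p ∘ onL Δ [FExcl (FWhynot A)] [FWhynot (FExcl A)] (Upsilon C ⟦A⟧);
  den_distR : forall Δ Γ B (p : LLKm Δ (FExcl (FWhynot B) :: Γ)),
    den (r_distR p)
    = onR [FExcl (FWhynot B)] [FWhynot (FExcl B)] Γ (Upsilon C ⟦B⟧) ∘ den p;
  den_tpL : forall Δ Γ A B E (p : LLKm (Δ ++ [FPar (FTens A B) E]) Γ),
    den (r_tpL p)
    = den p ∘ onL Δ [A; FPar B E] [FPar (FTens A B) E] (Omega C ⟦A⟧ ⟦B⟧ ⟦E⟧);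
  den_tpR : forall Δ Γ A B E (p : LLKm Δ (FTens A (FPar B E) :: Γ)),
    den (r_tpR p)
    = onR [FTens A (FPar B E)] [FTens A B; E] Γ (Omega C ⟦A⟧ ⟦B⟧ ⟦E⟧) ∘ den p
}.

End Interpretation.

Arguments onL {Atom C} v Δ Φ Ψ f.
Arguments onR {Atom C} v Φ Ψ Γ f.

(* Main.v *)
Require Import Defs.
From Stdlib Require Import List ProofIrrelevance.
Import ListNotations.

(** Linear application and currying survive in [♯C] although it is not closed.
    As [♯C] contains all morphisms to [⊥] and from [⊤], it contains the
    evaluation [A ⊗ ¬A -> ⊥] and the name [⊤ -> A ⊸ A ≅ ¬A ⅋ A] of the identity;
    with [Omega] they make [¬A ⅋ B] behave as an internal hom. The one rule that
    the structure does not interpret directly, the left rule for [?] in a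
    context [!X], is then the Kleisli extension of its curried premise
    [A -> !X ⊸ ?Y ≅ ?(X ⊸ Y)]. *)

Set Implicit Arguments.
Unset Strict Implicit.
Unset Printing Implicit Defensive.

Lemma sub_incl_inj (C : Category) (S : Lluf C) (A B : C)
    (f g : Hom (subcat S) A B) :
  sub_incl f = sub_incl g -> f = g.
Proof.
  intros e; apply eq_sig_hprop; [intros; apply proof_irrelevance|].
  exact e.
Qed.

Section SharpHom.
Context (C : BiLSMCC).
Local Notation D := (sharp (bdata C)).
Local Notation "1_ A" := (@idm D A) (at level 9).

Definition neg_eval (A : bdata C) : Hom D (tens A (neg A)) (bot (bdata C)) :=
  exist _
    (eval (nsc_closed (bnsc (bdata C))) A (bot (bdata C))
     ∘ swap (bw_sm (bnsc (bdata C))) A (neg A))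
    (lluf_to_bot _).

(** Evaluation at a general [B] is not assumed to lie in the subcategory, so it is routed through
    the one at [⊥]: [A ⊗ (¬A ⅋ B) -> (A ⊗ ¬A) ⅋ B -> ⊥ ⅋ B ≅ B]. *)
Definition sharp_apply (A B : bdata C) : Hom D (tens (lolli A B) A) B :=
  fwd (par_lunit B) ∘ spar (neg_eval A) (1_ B) ∘ Omega C A (neg A) B
  ∘ stens (1_ A) (fwd (lol_par C A B))
  ∘ swap (tens_sm (bdata C)) (lolli A B) A.

(** A morphism of the subcategory is determined by its underlying one in the ambient category, so
    [neg_eval] is the only possible [e]. *)
Lemma sharp_applyE (A B : bdata C)
    (e : Hom D (tens A (neg A)) (bot (bdata C))) :
  sub_incl e = eval (nsc_closed (bnsc (bdata C))) A (bot (bdata C))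
               ∘ swap (bw_sm (bnsc (bdata C))) A (neg A) ->
  sharp_apply A B
  = fwd (par_lunit B) ∘ spar e (1_ B) ∘ Omega C A (neg A) B
    ∘ stens (1_ A) (fwd (lol_par C A B))
    ∘ swap (tens_sm (bdata C)) (lolli A B) A.
Proof.
  intros He; replace e with (neg_eval A); [reflexivity|].
  apply sub_incl_inj; symmetry; exact He.
Qed.

Definition sharp_name (A B : bdata C) (f : Hom (bdata C) A B) :
    Hom D top (lolli A B) :=
  exist _
    (curry (nsc_closed (bnsc (bdata C)))
       (f ∘ fwd (lunit (bw_sm (bnsc (bdata C))) A)))
    (lluf_from_top _).

(** Transposition with [A ⅋ ¬A], the dual of the name of the identity, as unit: [X ≅ X ⊗ ⊤ -> X ⊗ (A
    ⅋ ¬A) -> (X ⊗ A) ⅋ ¬A -> B ⅋ ¬A ≅ A ⊸ B]. *)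
Definition sharp_curry (X A B : bdata C) (f : Hom D (tens X A) B) :
    Hom D X (lolli A B) :=
  bwd (lol_par C A B) ∘ par_swap B (neg A) ∘ spar f (1_ (neg A))
  ∘ Omega C X A (neg A)
  ∘ stens (1_ X)
      (par_swap (neg A) A ∘ fwd (lol_par C A A) ∘ sharp_name (idm A))
  ∘ bwd (runit (tens_sm (bdata C)) X).

(** Initiality gives [0 -> A ⊸ 0], which is then uncurried by [sharp_apply]. *)
Definition tens_zero (A : bdata C) :
    Hom D (tens A (zero (bdata C))) (zero (bdata C)) :=
  sharp_apply A (zero (bdata C)) ∘ swap (tens_sm (bdata C)) A _
  ∘ stens (1_ A) (from_initial (one_terminal (plus_fp (bdata C))) _).

(** [1] and [⊤] are both terminal in [♯C], so [1 ⅋ B ≅ B ⅋ ⊤ ≅ ⊤]. *)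
Definition to_one_par (X B : bdata C) : Hom D X (par one B) :=
  spar (bang_to (one_terminal (with_fp (bdata C))) top) (1_ B)
  ∘ par_swap B top ∘ bwd (par_top B) ∘ bang_to (top_terminal (bdata C)) X.

Definition strong_extension (X A Y : bdata C)
    (f : Hom D (tens (excl X) A) (whynot Y)) :
    Hom D (tens (excl X) (whynot A)) (whynot Y) :=
  sharp_apply (excl X) (whynot Y)
  ∘ swap (tens_sm (bdata C)) (excl X) _
  ∘ stens (1_ (excl X))
      (fwd (whynot_lol X Y) ∘ mult_whynot _
       ∘ swhynot (bwd (whynot_lol X Y)
                  ∘ sharp_curry (f ∘ swap (tens_sm (bdata C)) A (excl X)))).

End SharpHom.

Section Denotation.
Context (Atom : Type) (C : BiLSMCC) (v : Atom -> bdata C).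
Local Notation form := (form Atom).
Local Notation D := (sharp (bdata C)).
Local Notation "1_ A" := (@idm D A) (at level 9).
Local Notation "⟦ A ⟧" := (interp v A) (at level 0, A at level 99).
Local Notation lctx := (lctx v).
Local Notation rctx := (rctx v).
Local Notation lapp := (lapp v).
Local Notation rapp := (rapp v).
Local Notation lexcl := (lexcl v).
Local Notation rwhynot := (rwhynot v).

(** The restricted rule leaves no left context, so the curried premise has domain [⊤] and lies in
    the subcategory. Currying over all of [B, Γ] comes first; [A ⊸ (B, Γ) ≅ ¬A ⅋ (B ⅋ Γ)] then moves
    [Γ] out of the implication. *)
Definition lolR_den (Γ : list form) (A B : form)
    (f : Hom D (lctx [A]) (rctx (B :: Γ))) :
    Hom D (lctx []) (rctx (FLol A B :: Γ)) :=
  bwd (rapp [FLol A B] Γ)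
  ∘ spar (bwd (lol_par C ⟦A⟧ ⟦B⟧)) (1_ (rctx Γ))
  ∘ bwd (par_assoc (neg ⟦A⟧) ⟦B⟧ (rctx Γ))
  ∘ spar (1_ (neg ⟦A⟧)) (fwd (rapp [B] Γ))
  ∘ fwd (lol_par C ⟦A⟧ (rctx (B :: Γ)))
  ∘ sharp_name (sub_incl f).

(** The Seely isomorphisms pack a nonempty context into a single [!X] and the conclusion into a
    single [?Y], the shape that [whynot_lol] needs. The empty context is split off because there the
    plain Kleisli extension is prescribed, with which [strong_extension] is not shown to agree. *)
Definition whynotL_den (Δ Γ : list form) (A : form) :
    Hom D (lctx (map (@FExcl Atom) Δ ++ [A])) (rctx (map (@FWhynot Atom) Γ)) ->
    Hom D (lctx (map (@FExcl Atom) Δ ++ [FWhynot A]))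
      (rctx (map (@FWhynot Atom) Γ)) :=
  match Δ with
  | [] => fun f =>
      bwd (rwhynot Γ) ∘ mult_whynot _ ∘ swhynot (A := ⟦A⟧) (fwd (rwhynot Γ) ∘ f)
  | B :: Δ' => fun f =>
      bwd (rwhynot Γ)
      ∘ strong_extension
          (fwd (rwhynot Γ) ∘ f
           ∘ bwd (lapp (map (@FExcl Atom) (B :: Δ')) [A])
           ∘ stens (bwd (lexcl (B :: Δ'))) (1_ ⟦A⟧))
      ∘ stens (fwd (lexcl (B :: Δ'))) (1_ (whynot ⟦A⟧))
      ∘ fwd (lapp (map (@FExcl Atom) (B :: Δ')) [FWhynot A])
  end.

(** Clauses with a prescribed equation repeat its right-hand side, bracketing included, so that the
    equation holds by computation. *)
Fixpoint den_proof (Δ Γ : list form) (p : LLKm Δ Γ) :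
    Hom D (lctx Δ) (rctx Γ) :=
  match p in LLKm Δ Γ return Hom D (lctx Δ) (rctx Γ) with
  | r_id A => 1_ ⟦A⟧
  | @r_cut _ Δ Δ' Γ' B p q =>
      den_proof q ∘ bwd (lapp Δ' [B])
      ∘ swap (tens_sm (bdata C)) ⟦B⟧ (lctx Δ')
      ∘ stens (den_proof p) (1_ (lctx Δ')) ∘ fwd (lapp Δ Δ')
  | r_exL Δ Δ' A B p => den_proof p ∘ lexch v Δ Δ' A B
  | r_exR Γ Γ' A B p => rexch v Γ Γ' A B ∘ den_proof p
  | @r_topL _ Δ Γ p =>
      den_proof p ∘ fwd (runit (tens_sm (bdata C)) (lctx Δ))
      ∘ fwd (lapp Δ [FTop])
  | r_topR => 1_ top
  | r_botL => 1_ (bot (bdata C))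
  | @r_botR _ Δ Γ p =>
      bwd (rapp [FBot] Γ) ∘ bwd (par_lunit (rctx Γ)) ∘ den_proof p
  | r_oneR Δ Γ => bwd (rapp [FOne] Γ) ∘ to_one_par (lctx Δ) (rctx Γ)
  | r_zeroL Δ Γ =>
      from_initial (one_terminal (plus_fp (bdata C))) (rctx Γ)
      ∘ tens_zero (lctx Δ) ∘ fwd (lapp Δ [FZero])
  | @r_tensL _ Δ Γ A B p =>
      den_proof p ∘ onL v Δ [FTens A B] [A; B] (1_ (tens ⟦A⟧ ⟦B⟧))
  | @r_tensR _ Δ1 Δ2 A B p q =>
      stens (den_proof p) (den_proof q) ∘ fwd (lapp Δ1 Δ2)
  | @r_parL _ Γ1 Γ2 A B p q =>
      bwd (rapp Γ1 Γ2) ∘ spar (den_proof p) (den_proof q)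
  | @r_parR _ Δ Γ A B p =>
      onR v [A; B] [FPar A B] Γ (1_ (par ⟦A⟧ ⟦B⟧)) ∘ den_proof p
  | @r_withL1 _ Δ Γ A B p =>
      den_proof p
      ∘ onL v Δ [FWith A B] [A] (fst_ (with_fp (bdata C)) ⟦A⟧ ⟦B⟧)
  | @r_withL2 _ Δ Γ A B p =>
      den_proof p
      ∘ onL v Δ [FWith A B] [B] (snd_ (with_fp (bdata C)) ⟦A⟧ ⟦B⟧)
  | @r_withR _ Δ A B p q =>
      @pair_ D _ _ (with_fp (bdata C)) (lctx Δ) ⟦A⟧ ⟦B⟧
        (den_proof p) (den_proof q)
  | @r_plusL _ Γ A B p q =>
      @pair_ (op D) _ _ (plus_fp (bdata C)) (rctx Γ) ⟦A⟧ ⟦B⟧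
        (den_proof p) (den_proof q)
  | @r_plusR1 _ Δ Γ A B p =>
      onR v [A] [FPlus A B] Γ (fst_ (plus_fp (bdata C)) ⟦A⟧ ⟦B⟧) ∘ den_proof p
  | @r_plusR2 _ Δ Γ A B p =>
      onR v [B] [FPlus A B] Γ (snd_ (plus_fp (bdata C)) ⟦A⟧ ⟦B⟧) ∘ den_proof p
  | @r_lolL _ Δ1 Δ2 Γ1 Γ2 A B p q =>
      bwd (rapp Γ1 Γ2) ∘ par_swap (rctx Γ2) (rctx Γ1)
      ∘ spar (den_proof q ∘ bwd (lapp Δ2 [B])
              ∘ stens (1_ (lctx Δ2)) (sharp_apply ⟦A⟧ ⟦B⟧)
              ∘ fwd (assoc (tens_sm (bdata C))
                       (lctx Δ2) (lolli ⟦A⟧ ⟦B⟧) ⟦A⟧))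
          (1_ (rctx Γ1))
      ∘ Omega C (tens (lctx Δ2) (lolli ⟦A⟧ ⟦B⟧)) ⟦A⟧ (rctx Γ1)
      ∘ swap (tens_sm (bdata C)) (par ⟦A⟧ (rctx Γ1))
          (tens (lctx Δ2) (lolli ⟦A⟧ ⟦B⟧))
      ∘ stens (fwd (rapp [A] Γ1) ∘ den_proof p) (fwd (lapp Δ2 [FLol A B]))
      ∘ fwd (lapp Δ1 (Δ2 ++ [FLol A B]))
  | @r_lolR _ Γ A B p => lolR_den (den_proof p)
  | @r_exclW _ Δ Γ A p =>
      den_proof p ∘ fwd (runit (tens_sm (bdata C)) (lctx Δ))
      ∘ stens (1_ (lctx Δ)) (discard (sbwl (bdata C)) ⟦A⟧)
      ∘ fwd (lapp Δ [FExcl A])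
  | @r_exclC _ Δ Γ A p =>
      den_proof p
      ∘ onL v Δ [FExcl A] [FExcl A; FExcl A] (duplicate (sbwl (bdata C)) ⟦A⟧)
  | @r_exclD _ Δ Γ A p =>
      den_proof p ∘ onL v Δ [FExcl A] [A] (counit_excl ⟦A⟧)
  | @r_exclR _ Δ Γ B p =>
      bwd (rapp [FExcl B] (map (@FWhynot Atom) Γ))
      ∘ spar (1_ (excl ⟦B⟧)) (bwd (rwhynot Γ))
      ∘ Sigma C ⟦B⟧ _
      ∘ sexcl (spar (1_ ⟦B⟧) (fwd (rwhynot Γ))
               ∘ fwd (rapp [B] (map (@FWhynot Atom) Γ))
               ∘ den_proof p ∘ bwd (lexcl Δ))
      ∘ comult_excl _ ∘ fwd (lexcl Δ)
  | @r_whynotW _ Δ Γ B p =>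
      bwd (rapp [FWhynot B] Γ)
      ∘ spar (discard (sfwl (bdata C)) ⟦B⟧ : Hom D (bot (bdata C)) _)
          (1_ (rctx Γ))
      ∘ bwd (par_lunit (rctx Γ)) ∘ den_proof p
  | @r_whynotC _ Δ Γ B p =>
      onR v [FWhynot B; FWhynot B] [FWhynot B] Γ
        (duplicate (sfwl (bdata C)) ⟦B⟧) ∘ den_proof p
  | @r_whynotD _ Δ Γ B p =>
      onR v [B] [FWhynot B] Γ (unit_whynot ⟦B⟧) ∘ den_proof p
  | @r_whynotL _ Δ Γ A p => whynotL_den (den_proof p)
  | @r_distL _ Δ Γ A p =>
      den_proof p
      ∘ onL v Δ [FExcl (FWhynot A)] [FWhynot (FExcl A)] (Upsilon C ⟦A⟧)
  | @r_distR _ Δ Γ B p =>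
      onR v [FExcl (FWhynot B)] [FWhynot (FExcl B)] Γ (Upsilon C ⟦B⟧)
      ∘ den_proof p
  | @r_tpL _ Δ Γ A B E p =>
      den_proof p
      ∘ onL v Δ [A; FPar B E] [FPar (FTens A B) E] (Omega C ⟦A⟧ ⟦B⟧ ⟦E⟧)
  | @r_tpR _ Δ Γ A B E p =>
      onR v [FTens A (FPar B E)] [FTens A B; E] Γ (Omega C ⟦A⟧ ⟦B⟧ ⟦E⟧)
      ∘ den_proof p
  end.

End Denotation.

Theorem mainTheorem4 (Atom : Type) (C : BiLSMCC) (v : Atom -> bdata C) :
  inhabited (Semantics v).
Proof.
  constructor.
  unshelve refine {| den := @den_proof Atom C v;
                     annihilate := @tens_zero C;
                     apply := @sharp_apply C |}.
  (* This covers [den_lolR] too, because [sub_incl] of a composite computes to the composite of the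
     underlying morphisms. *)
  all: try reflexivity.
  - intros; apply sharp_applyE; assumption.
  (* [whynotL_den] sees the premise only through its denotation. *)
  - intros Δ Γ A p p' e; simpl; rewrite e; reflexivity.
Qed.
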